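(* We have $$\sum_{k=2}^\infty\left\lfloor\frac{k}{2}\right\rfloor\frac{\zeta(k)}{k\,2^k}=\frac{\ln(2)+\gamma}{4}$$ and $$\sum_{k=2}^\infty\left\lfloor\frac{k}{2}\right\rfloor\frac{\zeta(k)}{k\,2^{2k}}=\frac14\left(2\ln\Gamma\left(\frac14\right)+\frac{\gamma}{2}-\frac{\pi}{4}-\ln(2\pi)\right).$$
   Context: $\lfloor x\rfloor$ denotes the floor function, $\zeta(z)=\sum_{n=1}^\infty n^{-z}$ ($\Re(z)>1$) is the Riemann zeta function, $\Gamma$ is the Gamma function, and $\gamma=\lim_{n\to\infty}\left(\sum_{k=1}^n\frac1k-\ln n\right)$ is the Euler-Mascheroni constant. *)

(* Defs.v *)
From Stdlib Require Import Reals.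
From Coquelicot Require Import Coquelicot.
Open Scope R_scope.

(** The Riemann zeta function at a real argument; meaningful for [s > 1].
    The [n]-th term is [(n+1)^(-s)]. *)
Definition zeta (s : R) : R :=
  Series (fun n : nat => Rpower (INR (S n)) (- s)).

(** Euler's integral, improper at both ends; meaningful for [x > 0]. *)
Definition Gamma (x : R) : R :=
  RInt_gen (fun t : R => Rpower t (x - 1) * exp (- t))
    (at_right 0) (Rbar_locally p_infty).

Definition euler_gamma : R :=
  real (Lim_seq (fun n : nat =>
    sum_n_m (fun k : nat => 1 / INR k) 1 n - ln (INR n))).

Definition Rfloor (x : R) : R := IZR (Zfloor x).

(** [series_from m a l]: the series [a m + a (m+1) + ...] converges to [l]. *)
Definition series_from (m : nat) (a : nat -> R) (l : R) : Prop :=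
  is_series (fun n : nat => a (m + n)%nat) l.

(* Main.v *)
Require Import Defs.
From Stdlib Require Import Reals Lra Lia.
From Coquelicot Require Import Coquelicot.
Open Scope R_scope.

(** Write zeta(k) as its defining series and put [x = 1/2] or [x = 1/4].  All
    terms of the double series over [k >= 2] and [n >= 1] of
    floor(k/2) / k * (x/n)^k are nonnegative, so the order of summation may be
    exchanged ([tonelli_series]).  Since floor(k/2) = k/2 - (1 - (-1)^k)/4, the
    sum over [k] is a combination of a geometric series and two logarithm series,
    and with [y = x/n] it equals

      floor_gf y = y / (2 (1 - y)) + (ln (1 - y) - ln (1 + y)) / 4.

    It remains to sum [floor_gf (x/n)] over [n], that is, to find the limit of
    its partial sums.  With H_m for the harmonic numbers:

    For [x = 1/2] the logarithms telescope and the rational parts are the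
    1 / (2 (2n - 1)), whose sum is (H_(2m) - H_m / 2) / 2; the definition
    of the Euler constant gives the limit.

    For [x = 1/4] the rational parts are the 1 / (2 (4n - 1)).  The sum of the
    1 / (4n - 3) and the 1 / (4n - 1) is again a combination of harmonic numbers,
    and their difference is the Leibniz series of pi / 4.  The logarithms add up
    to the logarithm of the product of (4n - 1) / (4n + 1), and
      (4n - 1) / (4n + 1) = (1 - 1 / (16 n^2)) * (4n / (4n + 1))^2.
    The product of the first factors converges to sin(pi/4) / (pi/4) by Euler's
    product ([sine_product]); m^(1/4) times the product of the 4n / (4n + 1) up to
    m converges to Gamma(1/4) / 4 by Gauss's product ([Gauss_product_quarter]).
    Both products are evaluated in the manner of Wallis: finite products are
    integrals satisfying a two-term recurrence, and the limits come from squeezing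
    these integrals. *)

(** * Series of nonnegative terms *)

Lemma sum_n_le (a b : nat -> R) (N : nat) :
  (forall n, a n <= b n) -> sum_n a N <= sum_n b N.
Proof.
  intros Hab. rewrite !sum_n_Reals. apply sum_Rle. auto.
Qed.

Lemma sum_n_nonneg (a : nat -> R) (N : nat) :
  (forall n, 0 <= a n) -> 0 <= sum_n a N.
Proof.
  intros Ha. rewrite sum_n_Reals. apply cond_pos_sum. exact Ha.
Qed.

Lemma sum_n_S (a : nat -> R) (N : nat) : sum_n a (S N) = sum_n a N + a (S N).
Proof. exact (sum_Sn a N). Qed.

Lemma sum_n_le_series (a : nat -> R) (l : R) (N : nat) :
  (forall n, 0 <= a n) -> is_series a l -> sum_n a N <= l.
Proof.
  intros Ha Hl.
  apply (is_lim_seq_incr_compare (sum_n a) l Hl).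
  intro n. rewrite sum_n_S. specialize (Ha (S n)). lra.
Qed.

Lemma term_le_series (a : nat -> R) (l : R) (n : nat) :
  (forall n, 0 <= a n) -> is_series a l -> a n <= l.
Proof.
  intros Ha Hl.
  apply Rle_trans with (2 := sum_n_le_series a l n Ha Hl).
  destruct n as [|n].
  - rewrite sum_O. lra.
  - rewrite sum_n_S. pose proof (sum_n_nonneg a n Ha). lra.
Qed.

Lemma is_series_le (a b : nat -> R) (la lb : R) :
  (forall n, a n <= b n) -> is_series a la -> is_series b lb -> la <= lb.
Proof.
  intros Hab Ha Hb.
  apply (is_lim_seq_le (sum_n a) (sum_n b) la lb); auto.
  intro n. apply sum_n_le. exact Hab.
Qed.

Lemma is_series_sum_n (a : nat -> nat -> R) (l : nat -> R) (N : nat) :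
  (forall n, is_series (a n) (l n)) ->
  is_series (fun k => sum_n (fun n => a n k) N) (sum_n l N).
Proof.
  intros H. induction N as [|N IH].
  - rewrite sum_O. apply is_series_ext with (2 := H O).
    intro k. now rewrite sum_O.
  - rewrite sum_n_S.
    eapply is_series_ext;
      [ intro k; symmetry; apply (sum_n_S (fun n => a n k) N) | ].
    exact (is_series_plus _ _ _ _ IH (H (S N))).
Qed.

(** The row sums exist because each term [a n k] is at most the column sum [f n].
    Both inequalities between the two iterated sums then follow by comparing
    partial sums: a finite sum of rows is a series dominated by [f], and a finite
    sum of columns is a series dominated by the row sums. *)
Theorem tonelli_series (a : nat -> nat -> R) (f : nat -> R) (l : R) :
  (forall n k, 0 <= a n k) ->
  (forall n, is_series (a n) (f n)) ->
  is_series f l ->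
  is_series (fun k => Series (fun n => a n k)) l.
Proof.
  intros Ha Hf Hl.
  assert (Hr : forall k, is_series (fun n => a n k) (Series (fun n => a n k))).
  { intro k. apply Series_correct. apply (ex_series_le (fun n => a n k) f).
    - intro n. change (Rabs (a n k) <= f n). rewrite Rabs_pos_eq by apply Ha.
      apply term_le_series; auto.
    - now exists l. }
  set (r := fun k => Series (fun n => a n k)) in *.
  assert (r0 : forall k, 0 <= r k).
  { intro k. apply Rle_trans with (a O k); [ apply Ha | ].
    apply (term_le_series (fun n => a n k) (r k) O); auto. }
  assert (f0 : forall n, 0 <= f n).
  { intro n. apply Rle_trans with (a n O); [ apply Ha | ].
    apply term_le_series; auto. }
  assert (rle : forall K, sum_n r K <= l).
  { intro K.
    apply (is_series_le (fun n => sum_n (fun k => a n k) K) f); auto.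
    - intro n. apply sum_n_le_series; auto.
    - apply (is_series_sum_n (fun k n => a n k)). exact Hr. }
  destruct (ex_finite_lim_seq_incr (sum_n r) l) as [L HL]; auto.
  { intro n. rewrite sum_n_S. specialize (r0 (S n)). lra. }
  change (is_series r L) in HL.
  replace l with L; [ exact HL | ].
  apply Rle_antisym.
  - exact (is_lim_seq_le (sum_n r) (fun _ => l) L l rle HL (is_lim_seq_const l)).
  - apply (is_lim_seq_le (sum_n f) (fun _ => L) l L); auto using is_lim_seq_const.
    intro N.
    apply (is_series_le (fun k => sum_n (fun n => a n k) N) r); auto.
    + intro k. apply sum_n_le_series; auto.
    + apply is_series_sum_n. exact Hf.
Qed.

Lemma is_series_telescope (G a : nat -> R) (l : R) :
  G O = 0 -> (forall n, a n = G (S n) - G n) -> is_lim_seq G l -> is_series a l.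
Proof.
  intros H0 Ha Hl. change (is_lim_seq (sum_n a) l).
  apply is_lim_seq_incr_1 in Hl.
  apply is_lim_seq_ext with (2 := Hl).
  induction n as [|n IH].
  - rewrite sum_O, Ha. lra.
  - rewrite sum_n_S, <- IH, Ha. ring.
Qed.

(** * The sum over the exponent *)

(** Integrate the geometric series term by term over [0, y]. *)
Lemma is_series_neg_ln (y : R) :
  Rabs y < 1 -> is_series (fun k => y ^ S k / INR (S k)) (- ln (1 - y)).
Proof.
  intros Hy.
  set (u := fun _ : nat => 1).
  assert (HC : CV_radius u = 1).
  { replace (Finite 1) with (Finite (/ 1)) by (f_equal; field).
    apply (CV_radius_finite_DAlembert u 1); unfold u.
    - intros _. lra.
    - lra.
    - apply is_lim_seq_ext with (fun _ => 1); [ | apply is_lim_seq_const ].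
      intros _. rewrite Rabs_pos_eq; lra. }
  assert (Hu : forall x, Rabs x < 1 -> PSeries u x = / (1 - x)).
  { intros x Hx. apply is_series_unique.
    apply is_series_ext with (2 := is_series_geom x Hx).
    intro n. change (x ^ n = 1 * x ^ n). ring. }
  assert (HI : RInt (PSeries u) 0 y = - ln (1 - y)).
  { apply is_RInt_unique.
    assert (Hab : forall x, Rmin 0 y <= x <= Rmax 0 y -> Rabs x < 1).
    { intros x. unfold Rmin, Rmax. apply Rabs_def2 in Hy.
      destruct (Rle_dec 0 y); intros; apply Rabs_def1; lra. }
    apply is_RInt_ext with (f := fun x => / (1 - x)).
    { intros x Hx. symmetry. apply Hu. apply Hab. lra. }
    replace (- ln (1 - y)) with (minus (- ln (1 - y)) (- ln (1 - 0))).
    2:{ rewrite Rminus_0_r, ln_1. unfold minus, plus, opp; simpl. ring. }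
    apply (is_RInt_derive (fun x => - ln (1 - x)) (fun x => / (1 - x))).
    - intros x Hx. apply Hab, Rabs_def2 in Hx. auto_derive; [ lra | field; lra ].
    - intros x Hx. apply Hab, Rabs_def2 in Hx.
      apply (ex_derive_continuous (fun x => / (1 - x))). auto_derive. lra. }
  rewrite <- HI.
  assert (Hp : is_pseries (PS_Int u) y (RInt (PSeries u) 0 y)).
  { apply is_pseries_RInt. rewrite HC. exact Hy. }
  apply is_pseries_R in Hp.
  replace (RInt (PSeries u) 0 y)
    with (plus (RInt (PSeries u) 0 y) (PS_Int u 0 * y ^ 0)) in Hp.
  2:{ change (RInt (PSeries u) 0 y + 0 * 1 = RInt (PSeries u) 0 y). ring. }
  apply (is_series_incr_1 (fun k => PS_Int u k * y ^ k)) in Hp.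
  apply is_series_ext with (2 := Hp).
  intro k. change (u k / INR (S k) * y ^ S k = y ^ S k / INR (S k)).
  unfold u. field. apply not_0_INR. lia.
Qed.

(** The parity of [k] enters through a power of -1, so that the floor can be
    summed by power series. *)
Lemma Rfloor_half (k : nat) : Rfloor (INR k / 2) = INR k / 2 - (1 - (-1) ^ k) / 4.
Proof.
  destruct (even_odd_cor k) as [m [-> | ->]]; unfold Rfloor.
  - rewrite (Zfloor_eq (Z.of_nat m)).
    + rewrite <- INR_IZR_INZ, pow_1_even, mult_INR. simpl. lra.
    + rewrite <- INR_IZR_INZ, mult_INR. simpl. lra.
  - rewrite (Zfloor_eq (Z.of_nat m)).
    + rewrite <- INR_IZR_INZ, pow_1_odd, S_INR, mult_INR. simpl. lra.
    + rewrite <- INR_IZR_INZ, S_INR, mult_INR. simpl. lra.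
Qed.

Lemma Rfloor_half_nonneg (k : nat) : 0 <= Rfloor (INR k / 2).
Proof.
  rewrite Rfloor_half. destruct k as [|k]; [ simpl; lra | ].
  rewrite S_INR. pose proof (pos_INR k).
  destruct (even_odd_cor (S k)) as [m [Hm | Hm]];
    rewrite Hm; [ rewrite pow_1_even | rewrite pow_1_odd ]; lra.
Qed.

(** The power series with coefficients floor(k/2) / k, in closed form. *)
Definition floor_gf (y : R) : R := y / (2 * (1 - y)) + (ln (1 - y) - ln (1 + y)) / 4.

(** Sum the three parts of floor(k/2) / k = 1/2 - 1/(4k) + (-1)^k/(4k) from
    [k = 1], where the power series start naturally; the term at [k = 1] is 0. *)
Lemma floor_series (y : R) :
  Rabs y < 1 ->
  series_from 2 (fun k => Rfloor (INR k / 2) * (y ^ k / INR k)) (floor_gf y).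
Proof.
  intros Hy. unfold series_from.
  assert (Hy' : Rabs (- y) < 1) by now rewrite Rabs_Ropp.
  pose proof (is_series_scal_l (y / 2) _ _ (is_series_geom y Hy)) as H1.
  pose proof (is_series_scal_l (- (1 / 4)) _ _ (is_series_neg_ln y Hy)) as H2.
  pose proof (is_series_scal_l (1 / 4) _ _ (is_series_neg_ln (- y) Hy')) as H3.
  pose proof (is_series_plus _ _ _ _ (is_series_plus _ _ _ _ H1 H2) H3) as H.
  clear H1 H2 H3.
  apply (is_series_incr_1 (fun j => Rfloor (INR (S j) / 2) * (y ^ S j / INR (S j)))).
  replace (plus (floor_gf y) _) with (floor_gf y).
  2:{ rewrite Rfloor_half. unfold plus; simpl. lra. }
  eapply is_series_ext; [ | replace (floor_gf y) with
    (plus (plus (scal (y / 2) (/ (1 - y))) (scal (- (1 / 4)) (- ln (1 - y))))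
      (scal (1 / 4) (- ln (1 - - y)))); [ exact H | ]].
  - intro j. rewrite Rfloor_half.
    change (y / 2 * y ^ j + - (1 / 4) * (y ^ S j / INR (S j))
      + 1 / 4 * ((- y) ^ S j / INR (S j)) =
      (INR (S j) / 2 - (1 - (-1) ^ S j) / 4) * (y ^ S j / INR (S j))).
    replace (- y) with (-1 * y) by ring. rewrite Rpow_mult_distr.
    rewrite <- !tech_pow_Rmult. field. apply not_0_INR. lia.
  - change (y / 2 * / (1 - y) + - (1 / 4) * - ln (1 - y) + 1 / 4 * - ln (1 - - y)
            = floor_gf y).
    unfold floor_gf. replace (1 - - y) with (1 + y) by ring. apply Rabs_def2 in Hy. field. lra.
Qed.

Lemma floor_gf_div (a b : R) :
  0 < a < b -> floor_gf (a / b) = a / (2 * (b - a)) + (ln (b - a) - ln (b + a)) / 4.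
Proof.
  intros Hab. unfold floor_gf.
  replace (1 - a / b) with ((b - a) / b) by (field; lra).
  replace (1 + a / b) with ((b + a) / b) by (field; lra).
  rewrite !ln_div by lra. field. lra.
Qed.

Lemma zeta_nat (k : nat) : zeta (INR k) = Series (fun n => / INR (S n) ^ k).
Proof.
  apply Series_ext. intro n.
  rewrite Rpower_Ropp, Rpower_pow; [ reflexivity | apply lt_0_INR; lia ].
Qed.

(** This reduces the statement to a series over [n] in closed form: exchange the
    sums over [k] and over the [n] of the zeta series. *)
Theorem floor_zeta_series (x l : R) :
  0 <= x < 1 ->
  is_series (fun n => floor_gf (x / INR (S n))) l ->
  series_from 2 (fun k => Rfloor (INR k / 2) * (zeta (INR k) / INR k * x ^ k)) l.
Proof.
  intros Hx Hl. unfold series_from.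
  eapply is_series_ext;
    [ | apply (tonelli_series (fun n j => Rfloor (INR (2 + j) / 2) *
          ((x / INR (S n)) ^ (2 + j) / INR (2 + j)))
          (fun n => floor_gf (x / INR (S n))) l); [ | | exact Hl ] ].
  - intro j. rewrite zeta_nat.
    set (k := (2 + j)%nat).
    rewrite (Series_ext _ (fun n => (Rfloor (INR k / 2) * / INR k * x ^ k) * / INR (S n) ^ k)).
    2:{ intro n. unfold Rdiv. rewrite Rpow_mult_distr, pow_inv. ring. }
    rewrite Series_scal_l.
    change (Rfloor (INR k / 2) * / INR k * x ^ k * Series (fun n => / INR (S n) ^ k)
      = Rfloor (INR k / 2) * (Series (fun n => / INR (S n) ^ k) / INR k * x ^ k)).
    unfold Rdiv. ring.
  - intros n j. apply Rmult_le_pos; [ apply Rfloor_half_nonneg | ].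
    apply Rle_mult_inv_pos; [ | apply lt_0_INR; lia ].
    apply pow_le, Rle_mult_inv_pos; [ lra | apply lt_0_INR; lia ].
  - intro n. apply floor_series.
    assert (1 <= INR (S n)) by (rewrite S_INR; pose proof (pos_INR n); lra).
    assert (Hn : 0 < / INR (S n)) by (apply Rinv_0_lt_compat; lra).
    assert (Hn1 : / INR (S n) <= 1) by (rewrite <- Rinv_1; apply Rinv_le_contravar; lra).
    unfold Rdiv. rewrite Rabs_pos_eq; nra.
Qed.

(** * Harmonic numbers and the Euler constant *)

Lemma ln_le_sub1 (x : R) : 0 < x -> ln x <= x - 1.
Proof.
  intros Hx. pose proof (exp_ineq1_le (ln x)) as H.
  rewrite exp_ln in H by exact Hx. lra.
Qed.

Definition harmonic (n : nat) : R := sum_n_m (fun k : nat => 1 / INR k) 1 n.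

Lemma harmonic_0 : harmonic 0 = 0.
Proof. apply (sum_n_m_zero (G := R_AbelianMonoid)). lia. Qed.

Lemma harmonic_S (n : nat) : harmonic (S n) = harmonic n + 1 / INR (S n).
Proof. apply (sum_n_Sm (G := R_AbelianMonoid)). lia. Qed.

(** The limit in the definition of the constant exists: the sequence decreases
    from [n = 1] on and is nonnegative, both by comparing the increment of [ln]
    with 1/n and 1/(n+1). *)
Lemma is_lim_euler_gamma :
  is_lim_seq (fun n => harmonic n - ln (INR n)) euler_gamma.
Proof.
  assert (Hstep : forall n, / INR (S (S n)) <= ln (INR (S (S n))) - ln (INR (S n))
                            <= / INR (S n)).
  { intro n. rewrite (S_INR (S n)).
    assert (Hn : 0 < INR (S n)) by (apply lt_0_INR; lia).
    set (a := INR (S n)) in *.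
    rewrite <- ln_div by lra. split.
    - replace (ln ((a + 1) / a)) with (- ln (a / (a + 1))).
      2:{ rewrite !ln_div by lra. ring. }
      pose proof (ln_le_sub1 (a / (a + 1))) as H.
      assert (0 < a / (a + 1)) by (apply Rdiv_lt_0_compat; lra).
      replace (/ (a + 1)) with (1 - a / (a + 1)) by (field; lra). lra.
    - replace (/ a) with ((a + 1) / a - 1) by (field; lra).
      apply ln_le_sub1. apply Rdiv_lt_0_compat; lra. }
  assert (Hlow : forall n, ln (INR (S n)) <= harmonic n).
  { induction n as [|n IH].
    - rewrite harmonic_0. simpl. rewrite ln_1. lra.
    - rewrite harmonic_S. specialize (Hstep n). lra. }
  assert (Hex : ex_finite_lim_seq (fun n => harmonic n - ln (INR n))).
  { destruct (ex_finite_lim_seq_decr (fun n => harmonic (S n) - ln (INR (S n))) 0)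
      as [l Hl].
    - intro n. rewrite (harmonic_S (S n)). specialize (Hstep n). lra.
    - intro n. rewrite harmonic_S. specialize (Hlow n).
      assert (0 < / INR (S n)) by (apply Rinv_0_lt_compat, lt_0_INR; lia). lra.
    - exists l. apply is_lim_seq_incr_1. exact Hl. }
  exact (Lim_seq_correct' _ Hex).
Qed.

Lemma is_lim_seq_mul_index (u : nat -> R) (l : R) (c : nat) :
  (0 < c)%nat -> is_lim_seq u l -> is_lim_seq (fun n => u (c * n)%nat) l.
Proof.
  intros Hc Hu. apply (is_lim_seq_subseq u l (fun n => (c * n)%nat)); [ | exact Hu ].
  intros P [N HN]. exists N. intros n Hn. apply HN. nia.
Qed.

(** harmonic (2n) - harmonic n / 2 is the sum of the reciprocals of the odd
    numbers below 2n. *)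
Lemma is_lim_harmonic_half :
  is_lim_seq (fun n => harmonic (2 * n) - harmonic n / 2 - ln (INR n) / 2)
    (ln 2 + euler_gamma / 2).
Proof.
  pose proof is_lim_euler_gamma as H1.
  pose proof (is_lim_seq_mul_index _ _ 2 ltac:(lia) H1) as H2. cbv beta in H2.
  pose proof (is_lim_seq_scal_l _ (- (1 / 2)) _ H1) as H3.
  pose proof (is_lim_seq_plus' _ _ _ _ (is_lim_seq_const (ln 2))
    (is_lim_seq_plus' _ _ _ _ H2 H3)) as H.
  replace (ln 2 + euler_gamma / 2)
    with (ln 2 + (euler_gamma + - (1 / 2) * euler_gamma)) by field.
  apply is_lim_seq_ext_loc with (2 := H).
  exists 1%nat. intros n Hn.
  rewrite mult_INR, ln_mult;
    [ change (INR 2) with 2; field | change (INR 2) with 2; lra | apply lt_0_INR; lia ].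
Qed.

(** * The Leibniz series *)

(** The terms of the Leibniz series taken in [n] pairs; [sum_f_R0] includes the
    term at its upper index, so [n] pairs end at index 2(n-1) + 1. *)
Definition leibniz_sum (n : nat) : R :=
  match n with O => 0 | S m => sum_f_R0 (tg_alt PI_tg) (S (2 * m)) end.

Lemma leibniz_sum_S (n : nat) :
  leibniz_sum (S n) =
  leibniz_sum n + (/ (4 * INR n + 1) - / (4 * INR n + 3)).
Proof.
  assert (He : forall m, tg_alt PI_tg (2 * m) = / (4 * INR m + 1)).
  { intro m. unfold tg_alt, PI_tg. rewrite pow_1_even.
    replace (2 * (2 * m) + 1)%nat with (4 * m + 1)%nat by lia.
    rewrite plus_INR, mult_INR, !INR_IZR_INZ. simpl IZR. ring. }
  assert (Ho : forall m, tg_alt PI_tg (S (2 * m)) = - / (4 * INR m + 3)).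
  { intro m. unfold tg_alt, PI_tg. rewrite pow_1_odd.
    replace (2 * S (2 * m) + 1)%nat with (4 * m + 3)%nat by lia.
    rewrite plus_INR, mult_INR, !INR_IZR_INZ. simpl IZR. ring. }
  destruct n as [|n].
  - unfold leibniz_sum. rewrite tech5, Ho.
    change (sum_f_R0 (tg_alt PI_tg) (2 * 0)) with (tg_alt PI_tg (2 * 0)).
    rewrite He. ring.
  - unfold leibniz_sum at 1. rewrite tech5, Ho.
    replace (2 * S n)%nat with (S (S (2 * n))) by lia.
    rewrite tech5. replace (S (S (2 * n))) with (2 * S n)%nat by lia.
    rewrite He. unfold leibniz_sum. ring.
Qed.

Lemma is_lim_leibniz : is_lim_seq leibniz_sum (PI / 4).
Proof.
  rewrite <- Alt_PI_eq. unfold Alt_PI. destruct exist_PI as [a Ha].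
  replace (4 * a / 4) with a by field.
  apply is_lim_seq_incr_1.
  apply (is_lim_seq_subseq (sum_f_R0 (tg_alt PI_tg)) a (fun n => S (2 * n))).
  - intros P [N HN]. exists N. intros n Hn. apply HN. lia.
  - apply is_lim_seq_Reals. exact Ha.
Qed.

(** * Finite products, and integrals with a two-term recurrence *)

Fixpoint prod_from_1 (f : nat -> R) (n : nat) : R :=
  match n with O => 1 | S m => prod_from_1 f m * f (S m) end.

Lemma prod_from_1_S (f : nat -> R) (n : nat) : prod_from_1 f (S n) = prod_from_1 f n * f (S n).
Proof. reflexivity. Qed.

Lemma prod_from_1_pos (f : nat -> R) (n : nat) :
  (forall k, 0 < f (S k)) -> 0 < prod_from_1 f n.
Proof.
  intros Hf. induction n as [|n IH]; [ simpl; lra | ].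
  rewrite prod_from_1_S. now apply Rmult_lt_0_compat.
Qed.

(** Integration by parts without boundary terms, which is how the recurrences
    below arise: exhibit the primitive and check that it vanishes at both ends. *)
Lemma is_RInt_vanishing_primitive (F f : R -> R) (a b : R) :
  (forall x, is_derive F x (f x)) -> (forall x, continuous f x) ->
  F a = 0 -> F b = 0 -> is_RInt f a b 0.
Proof.
  intros HF Hf Ha Hb.
  replace 0 with (minus (F b) (F a)).
  - apply (is_RInt_derive (V := R_CompleteNormedModule)); auto.
  - rewrite Ha, Hb. exact (Rminus_diag 0).
Qed.

Lemma ex_RInt_ex_derive (f : R -> R) (a b : R) :
  (forall x, ex_derive f x) -> ex_RInt f a b.
Proof.
  intros Hf. apply (ex_RInt_continuous (V := R_CompleteNormedModule)).
  intros x _. apply (ex_derive_continuous (V := R_NormedModule)), Hf.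
Qed.

(** * Euler's product for the sine *)

(** The Wallis integral at [b = 0].  The step from [n - 2] to [n] multiplies the
    moment by n (n - 1) / (n^2 - b^2); for even [n] these multipliers for 0 and
    for [b] have as ratio the factor 1 - (b/n)^2 of Euler's product. *)
Definition cos_moment (b : R) (n : nat) : R :=
  RInt (fun t => cos (b * t) * cos t ^ n) 0 (PI / 2).

Lemma ex_RInt_cos_moment (b : R) (n : nat) :
  ex_RInt (fun t => cos (b * t) * cos t ^ n) 0 (PI / 2).
Proof. apply ex_RInt_ex_derive. intro t. auto_derive. trivial. Qed.

Lemma cos_moment_rec (b : R) (n : nat) :
  (INR (n + 2) ^ 2 - b ^ 2) * cos_moment b (n + 2) =
  INR (n + 2) * INR (n + 1) * cos_moment b n.
Proof.
  set (c := INR (n + 2) ^ 2 - b ^ 2). set (d := INR (n + 2) * INR (n + 1)).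
  assert (Hi : is_RInt (fun t => c * (cos (b * t) * cos t ^ (n + 2))
                                 - d * (cos (b * t) * cos t ^ n))
                 0 (PI / 2) (c * cos_moment b (n + 2) - d * cos_moment b n)).
  { apply (is_RInt_minus (V := R_NormedModule)); apply (is_RInt_scal (V := R_NormedModule));
      apply (RInt_correct (V := R_CompleteNormedModule)); apply ex_RInt_cos_moment. }
  assert (H0 : is_RInt (fun t => c * (cos (b * t) * cos t ^ (n + 2))
                                 - d * (cos (b * t) * cos t ^ n)) 0 (PI / 2) 0).
  { apply is_RInt_vanishing_primitive with
      (F := fun t => INR (n + 2) * cos t ^ (n + 1) * sin t * cos (b * t)
                     - b * sin (b * t) * cos t ^ (n + 2)).
    - intro t. unfold c, d.
      replace (n + 2)%nat with (S (S n)) by lia. replace (n + 1)%nat with (S n) by lia.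
      auto_derive; [ trivial | ].
      change (match n with O => 1 | S _ => INR n + 1 end) with (INR (S n)).
      rewrite <- !tech_pow_Rmult, !S_INR.
      pose proof (sin2_cos2 t) as Hs. unfold Rsqr in Hs.
      set (s := sin t) in *. set (k := cos t) in *. set (q := k ^ n).
      set (A := cos (b * t)). set (B := sin (b * t)).
      (* The two sides differ by a multiple of cos^2 + sin^2 - 1. *)
      match goal with |- ?l = ?r =>
        replace l with (r + (INR n + 1 + 1) * (INR n + 1) * q * A * (1 - k * k - s * s))
      end.
      { replace (s * s) with (1 - k * k) by lra. ring. }
      ring.
    - intro t. apply (ex_derive_continuous (V := R_NormedModule)). auto_derive. trivial.
    - rewrite Rmult_0_r, sin_0. ring.
    - rewrite cos_PI2, !pow_i by lia. ring. }
  apply (is_RInt_unique (V := R_CompleteNormedModule)) in Hi.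
  apply (is_RInt_unique (V := R_CompleteNormedModule)) in H0.
  lra.
Qed.

Lemma cos_moment0_pos (n : nat) : 0 < cos_moment 0 n.
Proof.
  apply RInt_gt_0.
  - apply PI2_RGT_0.
  - intros t Ht. rewrite Rmult_0_l, cos_0.
    apply Rmult_lt_0_compat; [ lra | apply pow_lt, cos_gt_0; lra ].
  - intros t _. apply (ex_derive_continuous (V := R_NormedModule)). auto_derive. trivial.
Qed.

(** On [0, pi/2] one has cos^2 t <= cos t <= cos (b t) <= 1. *)
Lemma cos_moment_squeeze (b : R) (n : nat) :
  0 <= b <= 1 -> cos_moment 0 (n + 2) <= cos_moment b n <= cos_moment 0 n.
Proof.
  intros Hb. pose proof PI2_RGT_0.
  split; (apply RInt_le; [ lra | apply ex_RInt_cos_moment.. | ]);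
    intros t Ht; rewrite Rmult_0_l, cos_0;
    assert (Hc : 0 < cos t) by (apply cos_gt_0; lra);
    pose proof (pow_lt _ n Hc); pose proof (COS_bound t); pose proof (COS_bound (b * t)).
  - assert (cos t <= cos (b * t)) by (apply cos_decr_1; nra).
    rewrite pow_add, Rmult_1_l, Rmult_comm. apply Rmult_le_compat_r; [ lra | ].
    simpl. nra.
  - nra.
Qed.

(** The ratio r of the even moments for [b] and for 0 is multiplied at each step by
    the inverse of a factor of the product, so r times the product is constant,
    equal to its value at 0, which is the right-hand side.  And r tends to 1 by
    [cos_moment_squeeze], as consecutive even Wallis integrals have ratio
    tending to 1. *)
Theorem sine_product (b : R) :
  0 < b <= 1 ->
  is_lim_seq (prod_from_1 (fun k => 1 - (b / (2 * INR k)) ^ 2))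
    (sin (b * (PI / 2)) / (b * (PI / 2))).
Proof.
  intros Hb.
  set (P := prod_from_1 (fun k => 1 - (b / (2 * INR k)) ^ 2)).
  set (r := fun m => cos_moment b (2 * m) / cos_moment 0 (2 * m)).
  assert (HW : forall m, cos_moment 0 (2 * m + 2)
             = (2 * INR m + 1) / (2 * INR m + 2) * cos_moment 0 (2 * m)).
  { intro m. pose proof (cos_moment_rec 0 (2 * m)) as H.
    rewrite !plus_INR, mult_INR in H. simpl INR in H. pose proof (pos_INR m).
    apply Rmult_eq_reg_l with ((2 * INR m + 2) ^ 2); [ | nra ].
    replace ((2 * INR m + 2) ^ 2) with (((1 + 1) * INR m + (1 + 1)) ^ 2 - 0 ^ 2) at 1 by ring.
    rewrite H. field. lra. }
  assert (Hr : forall m, r m * P m = sin (b * (PI / 2)) / (b * (PI / 2))).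
  { induction m as [|m IH].
    - unfold r, P, prod_from_1. simpl (2 * 0)%nat.
      assert (HJ : forall c, c <> 0 -> cos_moment c 0 = sin (c * (PI / 2)) / c).
      { intros c Hc. apply is_RInt_unique.
        replace (sin (c * (PI / 2)) / c)
          with (minus (sin (c * (PI / 2)) / c) (sin (c * 0) / c)).
        2:{ rewrite Rmult_0_r, sin_0. unfold minus, plus, opp; simpl. field. exact Hc. }
        apply (is_RInt_derive (fun t => sin (c * t) / c)).
        - intros t _. auto_derive; [ trivial | field; exact Hc ].
        - intros t _. apply (ex_derive_continuous (V := R_NormedModule)).
          auto_derive. trivial. }
      assert (HJ0 : cos_moment 0 0 = PI / 2).
      { unfold cos_moment.
        rewrite (RInt_ext _ (fun _ => 1)).
        - rewrite RInt_const. unfold scal; simpl; unfold mult; simpl. ring.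
        - intros t _. rewrite Rmult_0_l, cos_0. simpl. ring. }
      rewrite HJ, HJ0 by lra. pose proof PI2_RGT_0. field. lra.
    - rewrite <- IH. unfold r, P. rewrite prod_from_1_S. fold P.
      replace (2 * S m)%nat with (2 * m + 2)%nat by lia.
      pose proof (cos_moment_rec b (2 * m)) as H. rewrite HW.
      rewrite !plus_INR, mult_INR in H. simpl (INR 2) in H. simpl (INR 1) in H.
      rewrite S_INR. pose proof (pos_INR m). pose proof (cos_moment0_pos (2 * m)).
      set (x := INR m) in *.
      assert (Hd : 0 < (2 * x + 2) ^ 2 - b ^ 2) by nra.
      replace (cos_moment b (2 * m + 2)) with
        ((2 * x + 2) * (2 * x + 1) * cos_moment b (2 * m) / ((2 * x + 2) ^ 2 - b ^ 2)).
      2:{ apply Rmult_eq_reg_l with ((2 * x + 2) ^ 2 - b ^ 2); [ | lra ].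
          replace (((2 * x + 2) ^ 2 - b ^ 2) * cos_moment b (2 * m + 2))
            with ((((1 + 1) * x + (1 + 1)) ^ 2 - b ^ 2) * cos_moment b (2 * m + 2)) by ring.
          rewrite H. field. lra. }
      field. repeat split; lra. }
  assert (Hb1 : forall m, 1 - / (2 * INR m + 2) <= r m <= 1).
  { intro m. pose proof (cos_moment0_pos (2 * m)) as Hp. pose proof (pos_INR m).
    destruct (cos_moment_squeeze b (2 * m)) as [H1 H2]; [ lra | ].
    rewrite HW in H1. unfold r. split.
    - apply Rmult_le_reg_r with (1 := Hp).
      replace (cos_moment b (2 * m) / cos_moment 0 (2 * m) * cos_moment 0 (2 * m))
        with (cos_moment b (2 * m)) by (field; lra).
      replace (1 - / (2 * INR m + 2)) with ((2 * INR m + 1) / (2 * INR m + 2)) by (field; lra).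
      exact H1.
    - apply Rmult_le_reg_r with (1 := Hp).
      replace (cos_moment b (2 * m) / cos_moment 0 (2 * m) * cos_moment 0 (2 * m))
        with (cos_moment b (2 * m)) by (field; lra). lra. }
  assert (Hlim : is_lim_seq r 1).
  { apply is_lim_seq_le_le with (fun m => 1 - / (2 * INR m + 2)) (fun _ => 1).
    - exact Hb1.
    - replace 1 with (1 - 0) at 1 by ring.
      apply is_lim_seq_minus'; [ apply is_lim_seq_const | ].
      replace (Finite 0) with (Rbar_inv p_infty) by reflexivity.
      apply is_lim_seq_inv; [ | discriminate ].
      apply is_lim_seq_le_p_loc with INR; [ | apply is_lim_seq_INR ].
      exists O. intros m _. pose proof (pos_INR m). lra.
    - apply is_lim_seq_const. }
  replace (sin (b * (PI / 2)) / (b * (PI / 2)))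
    with (sin (b * (PI / 2)) / (b * (PI / 2)) / 1) by apply Rdiv_1_r.
  apply is_lim_seq_ext with (fun m => sin (b * (PI / 2)) / (b * (PI / 2)) / r m).
  - intro m. rewrite <- (Hr m). specialize (Hb1 m). pose proof (pos_INR m).
    assert (/ (2 * INR m + 2) < 1).
    { rewrite <- Rinv_1. apply Rinv_lt_contravar; lra. }
    field. lra.
  - apply is_lim_seq_div'; [ apply is_lim_seq_const | exact Hlim | lra ].
Qed.

(** * Gamma(1/4) as an integral over the half-line *)

(** Substituting [t = u^4] in Euler's integral for Gamma(1/4) removes the
    singularity at 0, and gives 4 times this integral up to infinity. *)
Definition quartic_exp_integral (x : R) : R := RInt (fun u => exp (- u ^ 4)) 0 x.

Lemma ex_RInt_quartic_exp (a b : R) : ex_RInt (fun u => exp (- u ^ 4)) a b.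
Proof. apply ex_RInt_ex_derive. intro u. auto_derive. trivial. Qed.

Lemma is_derive_quartic_exp_integral (x : R) :
  is_derive quartic_exp_integral x (exp (- x ^ 4)).
Proof.
  apply (is_derive_RInt (V := R_NormedModule) (fun u => exp (- u ^ 4)) _ 0).
  - apply filter_forall. intro b.
    apply (RInt_correct (V := R_CompleteNormedModule)), ex_RInt_quartic_exp.
  - apply (ex_derive_continuous (V := R_NormedModule)). auto_derive. trivial.
Qed.

Lemma quartic_exp_integral_bounds (x : R) :
  0 <= x -> 0 <= quartic_exp_integral x <= x.
Proof.
  intros Hx. split.
  - apply RInt_ge_0; [ exact Hx | apply ex_RInt_quartic_exp | ].
    intros u _. left. apply exp_pos.
  - replace x with (RInt (fun _ => 1) 0 x) at 2.
    + apply RInt_le; [ exact Hx | apply ex_RInt_quartic_exp | apply ex_RInt_const | ].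
      intros u _. rewrite <- exp_0.
      assert (0 <= u ^ 4) by (replace (u ^ 4) with ((u ^ 2) ^ 2) by ring; apply pow2_ge_0).
      destruct (Req_dec (u ^ 4) 0) as [-> | Hn]; [ rewrite Ropp_0; lra | ].
      left. apply exp_increasing. lra.
    + rewrite RInt_const. unfold scal; simpl; unfold mult; simpl. ring.
Qed.

Lemma quartic_exp_integral_incr (x y : R) :
  x <= y -> quartic_exp_integral x <= quartic_exp_integral y.
Proof.
  intros Hxy.
  assert (H : quartic_exp_integral x + RInt (fun u => exp (- u ^ 4)) x y
              = quartic_exp_integral y).
  { apply (RInt_Chasles (V := R_CompleteNormedModule)); apply ex_RInt_quartic_exp. }
  assert (0 <= RInt (fun u => exp (- u ^ 4)) x y).
  { apply RInt_ge_0; [ exact Hxy | apply ex_RInt_quartic_exp | ].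
    intros u _. left. apply exp_pos. }
  lra.
Qed.

(** Compare with the integral of 2 / (1 + u^2), which is 2 atan. *)
Lemma quartic_exp_integral_le_PI (x : R) : 0 <= x -> quartic_exp_integral x <= PI.
Proof.
  intros Hx.
  assert (Ha : is_RInt (fun u => 2 / (1 + u ^ 2)) 0 x (2 * atan x)).
  { replace (2 * atan x) with (minus (2 * atan x) (2 * atan 0)).
    2:{ rewrite atan_0. unfold minus, plus, opp; simpl. ring. }
    apply (is_RInt_derive (V := R_CompleteNormedModule) (fun u => 2 * atan u)).
    - intros u _. auto_derive; [ trivial | unfold Rsqr; field; nra ].
    - intros u _. apply (ex_derive_continuous (V := R_NormedModule)).
      auto_derive. nra. }
  apply Rle_trans with (2 * atan x).
  - apply (is_RInt_le (fun u => exp (- u ^ 4)) (fun u => 2 / (1 + u ^ 2)) 0 x); auto.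
    + apply (RInt_correct (V := R_CompleteNormedModule)), ex_RInt_quartic_exp.
    + intros u _. rewrite exp_Ropp.
      assert (H0 : 0 < 1 + u ^ 2) by nra.
      assert (H1 : 1 + u ^ 2 <= 2 * (1 + u ^ 4)).
      { replace (u ^ 4) with ((u ^ 2) ^ 2) by ring. nra. }
      pose proof (exp_ineq1_le (u ^ 4)) as H2. pose proof (exp_pos (u ^ 4)).
      apply Rmult_le_reg_l with (exp (u ^ 4)); [ lra | ].
      rewrite Rinv_r by lra.
      apply Rmult_le_reg_r with (1 + u ^ 2); [ lra | ].
      replace (exp (u ^ 4) * (2 / (1 + u ^ 2)) * (1 + u ^ 2)) with (2 * exp (u ^ 4))
        by (field; lra). lra.
  - pose proof (atan_bound x). lra.
Qed.

(** An increasing bounded function; positivity is needed later for [ln Gamma(1/4)]. *)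
Lemma quartic_exp_integral_lim :
  exists L, 0 < L /\ is_lim quartic_exp_integral p_infty L.
Proof.
  destruct (ex_finite_lim_seq_incr (fun n => quartic_exp_integral (INR n)) PI) as [L HL].
  - intro n. apply quartic_exp_integral_incr. rewrite S_INR. lra.
  - intro n. apply quartic_exp_integral_le_PI, pos_INR.
  - assert (Hle : forall n, quartic_exp_integral (INR n) <= L).
    { apply (is_lim_seq_incr_compare (fun n => quartic_exp_integral (INR n))); [ exact HL | ].
      intro n. apply quartic_exp_integral_incr. rewrite S_INR. lra. }
    exists L. split.
    + apply Rlt_le_trans with (2 := Hle 1%nat).
      apply RInt_gt_0; [ simpl; lra | | ].
      * intros u _. apply exp_pos.
      * intros u _. apply (ex_derive_continuous (V := R_NormedModule)).
        auto_derive. trivial.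
    + apply is_lim_spec. apply is_lim_seq_spec in HL. intro eps.
      destruct (HL eps) as [N HN]. exists (INR N). intros x Hx.
      specialize (HN N (le_n N)).
      apply Rabs_def2 in HN. destruct HN as [_ HN].
      pose proof (quartic_exp_integral_incr (INR N) x (Rlt_le _ _ Hx)).
      destruct (nfloor_ex x) as [m Hm]; [ pose proof (pos_INR N); lra | ].
      pose proof (quartic_exp_integral_incr x (INR (S m))) as H1.
      rewrite S_INR in H1. specialize (H1 ltac:(lra)). rewrite <- S_INR in H1.
      specialize (Hle (S m)). pose proof (cond_pos eps).
      apply Rabs_def1; lra.
Qed.

Definition root4 (t : R) : R := Rpower t (1 / 4).

Lemma root4_pos (t : R) : 0 < root4 t.
Proof. apply exp_pos. Qed.

Lemma root4_pow (t : R) : 0 < t -> root4 t ^ 4 = t.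
Proof.
  intros Ht. rewrite <- Rpower_pow by apply root4_pos.
  unfold root4. rewrite Rpower_mult.
  replace (1 / 4 * INR 4) with 1 by (simpl; field). now apply Rpower_1.
Qed.

Lemma root4_lt (t c : R) : 0 < t -> 0 <= c -> t < c ^ 4 -> root4 t < c.
Proof.
  intros Ht Hc H. rewrite <- (root4_pow t Ht) in H.
  apply Rnot_le_lt. intro Hle. pose proof (pow_incr c (root4 t) 4). lra.
Qed.

Lemma lt_root4 (t c : R) : 0 < t -> 0 <= c -> c ^ 4 < t -> c < root4 t.
Proof.
  intros Ht Hc H. rewrite <- (root4_pow t Ht) in H.
  apply Rnot_le_lt. intro Hle. pose proof (root4_pos t).
  pose proof (pow_incr (root4 t) c 4). lra.
Qed.

Lemma is_derive_Gamma_primitive (t : R) :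
  0 < t ->
  is_derive (fun t => 4 * quartic_exp_integral (root4 t)) t
    (Rpower t (1 / 4 - 1) * exp (- t)).
Proof.
  intros Ht.
  assert (Hr : is_derive root4 t (1 / 4 * Rpower t (1 / 4 - 1))).
  { apply is_derive_Reals, derivable_pt_lim_power. exact Ht. }
  pose proof (is_derive_comp (V := R_NormedModule) quartic_exp_integral root4 t _ _
    (is_derive_quartic_exp_integral (root4 t)) Hr) as H.
  apply (is_derive_scal _ _ 4) in H.
  rewrite root4_pow in H by exact Ht.
  replace (Rpower t (1 / 4 - 1) * exp (- t))
    with (4 * scal (1 / 4 * Rpower t (1 / 4 - 1)) (exp (- t))); [ exact H | ].
  unfold scal; simpl; unfold mult; simpl. field.
Qed.

Lemma is_RInt_Gamma_integrand (a b : R) :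
  0 < a -> 0 < b ->
  is_RInt (fun t => Rpower t (1 / 4 - 1) * exp (- t)) a b
    (4 * quartic_exp_integral (root4 b) - 4 * quartic_exp_integral (root4 a)).
Proof.
  intros Ha Hb.
  assert (Hp : forall t, Rmin a b <= t <= Rmax a b -> 0 < t).
  { intros t [H _]. apply Rlt_le_trans with (2 := H). now apply Rmin_glb_lt. }
  apply (is_RInt_derive (V := R_CompleteNormedModule)
    (fun t => 4 * quartic_exp_integral (root4 t))).
  - intros t Ht. apply is_derive_Gamma_primitive. auto.
  - intros t Ht. apply (ex_derive_continuous (V := R_NormedModule)).
    unfold Rpower. auto_derive. auto.
Qed.

(** The primitive of Euler's integrand found above tends to 0 at 0 because the
    quartic integral up to [x] is at most [x], and it converges at infinity by
    [quartic_exp_integral_lim]. *)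
Theorem Gamma_quarter :
  0 < Gamma (1 / 4) /\ is_lim quartic_exp_integral p_infty (Gamma (1 / 4) / 4).
Proof.
  destruct quartic_exp_integral_lim as [L [HL0 HL]].
  assert (HG : Gamma (1 / 4) = 4 * L).
  { apply is_RInt_gen_unique. intros P [eps HP].
    apply is_lim_spec in HL.
    assert (Heps : 0 < eps / 8) by (pose proof (cond_pos eps); lra).
    destruct (HL (mkposreal _ Heps)) as [M HM]. simpl in HM.
    set (c := Rmax M 0).
    assert (HM' : M <= c) by apply Rmax_l.
    assert (Hc : 0 <= c) by apply Rmax_r.
    apply Filter_prod with (Q := fun a => 0 < a < (eps / 8) ^ 4)
                           (R := fun b => c ^ 4 < b).
    - assert (Hd : 0 < (eps / 8) ^ 4) by (apply pow_lt; lra).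
      exists (mkposreal _ Hd). intros a Ha Ha0.
      change (Rabs (a - 0) < (eps / 8) ^ 4) in Ha.
      rewrite Rminus_0_r, Rabs_pos_eq in Ha; lra.
    - exists (c ^ 4). auto.
    - intros a b [Ha0 Ha] Hb. simpl.
      assert (Hb0 : 0 < b) by (pose proof (pow_le c 4 Hc); lra).
      eexists. split; [ apply is_RInt_Gamma_integrand; assumption | ].
      apply HP.
      change (Rabs (4 * quartic_exp_integral (root4 b)
                    - 4 * quartic_exp_integral (root4 a) - 4 * L) < eps).
      pose proof (root4_lt a (eps / 8) Ha0 ltac:(lra) Ha).
      pose proof (lt_root4 b c Hb0 Hc Hb).
      pose proof (quartic_exp_integral_bounds (root4 a) (Rlt_le _ _ (root4_pos a))).
      specialize (HM (root4 b) ltac:(lra)). apply Rabs_def2 in HM.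
      apply Rabs_def1; lra. }
  rewrite HG. split; [ lra | ].
  replace (4 * L / 4) with L by field. exact HL.
Qed.

(** * Gauss's product for Gamma(1/4) *)

(** A Beta integral in disguise.  Replacing exp (- u^4) by (1 - u^4/n)^n on
    [0, n^(1/4)] and rescaling to [0, 1] turns the quartic integral into n^(1/4)
    times this one. *)
Definition quartic_beta (n : nat) : R := RInt (fun v => (1 - v ^ 4) ^ n) 0 1.

Lemma ex_RInt_quartic_beta (n : nat) : ex_RInt (fun v => (1 - v ^ 4) ^ n) 0 1.
Proof. apply ex_RInt_ex_derive. intro v. auto_derive. trivial. Qed.

(** The derivative of v (1 - v^4)^(n+1) gives
    (4n + 5) quartic_beta (n+1) = (4n + 4) quartic_beta n. *)
Lemma quartic_beta_prod (n : nat) :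
  quartic_beta n = prod_from_1 (fun k => 4 * INR k / (4 * INR k + 1)) n.
Proof.
  induction n as [|n IH].
  - unfold quartic_beta, prod_from_1. simpl. rewrite RInt_const.
    unfold scal; simpl; unfold mult; simpl. ring.
  - rewrite prod_from_1_S, <- IH, S_INR. pose proof (pos_INR n).
    set (c := 4 * (INR n + 1)). assert (Hc : 0 < c) by (unfold c; lra).
    assert (Hi : is_RInt (fun v => (c + 1) * (1 - v ^ 4) ^ S n - c * (1 - v ^ 4) ^ n)
                   0 1 ((c + 1) * quartic_beta (S n) - c * quartic_beta n)).
    { apply (is_RInt_minus (V := R_NormedModule));
        apply (is_RInt_scal (V := R_NormedModule));
        apply (RInt_correct (V := R_CompleteNormedModule)); apply ex_RInt_quartic_beta. }
    assert (H0 : is_RInt (fun v => (c + 1) * (1 - v ^ 4) ^ S n - c * (1 - v ^ 4) ^ n)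
                   0 1 0).
    { apply is_RInt_vanishing_primitive with (F := fun v => v * (1 - v ^ 4) ^ S n).
      - intro v. unfold c. auto_derive; [ trivial | ].
        change (match n with O => 1 | S _ => INR n + 1 end) with (INR (S n)).
        rewrite S_INR. simpl. unfold Rminus.
        set (q := (1 + - (v * (v * (v * (v * 1))))) ^ n). ring.
      - intro v. apply (ex_derive_continuous (V := R_NormedModule)). auto_derive. trivial.
      - ring.
      - replace (1 - 1 ^ 4) with 0 by ring. rewrite pow_i by lia. ring. }
    apply (is_RInt_unique (V := R_CompleteNormedModule)) in Hi.
    apply (is_RInt_unique (V := R_CompleteNormedModule)) in H0.
    apply Rmult_eq_reg_l with (c + 1); [ | lra ].
    replace ((c + 1) * (quartic_beta n * (c / (c + 1)))) with (c * quartic_beta n)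
      by (field; lra). lra.
Qed.

Lemma sq_le_exp (t : R) : 0 <= t -> t ^ 2 <= exp t.
Proof.
  intros Ht.
  assert (H : t <= exp (t / 2)).
  { replace (t / 2) with (1 + (t / 2 - 1)) by ring. rewrite exp_plus.
    pose proof (exp_ineq1_le 1). pose proof (exp_ineq1_le (t / 2 - 1)).
    pose proof (exp_pos (t / 2 - 1)). nra. }
  replace (exp t) with (exp (t / 2) * exp (t / 2)).
  - nra.
  - rewrite <- exp_plus. f_equal. field.
Qed.

Lemma exp_mult_nat (n : nat) (x : R) : exp (INR n * x) = exp x ^ n.
Proof.
  rewrite <- Rpower_pow by apply exp_pos. unfold Rpower. now rewrite ln_exp.
Qed.

(** The upper bound is 1 - s <= exp (-s).  For the lower one, 1 + s <= exp s gives
    1 - s >= exp (-s) (1 - s^2); raise it to the power [n] with Bernoulli's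
    inequality and bound (n s)^2 exp (- n s) by 1. *)
Lemma pow_one_sub_bounds (n : nat) (s : R) :
  (0 < n)%nat -> 0 <= s <= 1 ->
  exp (- (INR n * s)) - / INR n <= (1 - s) ^ n <= exp (- (INR n * s)).
Proof.
  intros Hn Hs.
  assert (Hn0 : 0 < INR n) by (apply lt_0_INR; lia).
  replace (- (INR n * s)) with (INR n * - s) by ring. rewrite exp_mult_nat.
  pose proof (exp_pos (- s)) as He.
  split.
  - assert (H1 : exp (- s) * (1 - s ^ 2) <= 1 - s).
    { rewrite exp_Ropp. pose proof (exp_ineq1_le s). pose proof (exp_pos s).
      apply Rmult_le_reg_l with (exp s); [ lra | ].
      rewrite <- Rmult_assoc, Rinv_r by lra. nra. }
    assert (H2 : 1 - INR n * s ^ 2 <= (1 - s ^ 2) ^ n).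
    { replace (1 - INR n * s ^ 2) with (1 + INR n * (- s ^ 2)) by ring.
      assert (forall m, 1 + INR m * (- s ^ 2) <= (1 - s ^ 2) ^ m) as Hb; [ | apply Hb ].
      induction m as [|m IH]; [ simpl; lra | ].
      rewrite S_INR. simpl pow. pose proof (pos_INR m).
      assert (0 <= 1 - s * (s * 1) <= 1) by nra. 
      assert (0 <= INR m * (s * s) * (s * s)) by (apply Rmult_le_pos; nra).
      simpl in IH. nra. }
    assert (H3 : exp (- s) ^ n * (1 - s ^ 2) ^ n <= (1 - s) ^ n).
    { rewrite <- Rpow_mult_distr. apply pow_incr. split; [ | exact H1 ].
      apply Rmult_le_pos; nra. }
    pose proof (pow_lt _ n He) as Hp.
    assert (H4 : (INR n * s) ^ 2 * exp (- s) ^ n <= 1).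
    { rewrite <- exp_mult_nat. replace (INR n * - s) with (- (INR n * s)) by ring.
      rewrite exp_Ropp. pose proof (exp_pos (INR n * s)).
      apply Rmult_le_reg_r with (exp (INR n * s)); [ lra | ].
      rewrite Rmult_assoc, Rinv_l by lra.
      pose proof (sq_le_exp (INR n * s)). nra. }
    assert (H5 : INR n * s ^ 2 * exp (- s) ^ n <= / INR n).
    { apply Rmult_le_reg_l with (INR n); [ lra | ]. rewrite Rinv_r by lra.
      replace (INR n * (INR n * s ^ 2 * exp (- s) ^ n))
        with ((INR n * s) ^ 2 * exp (- s) ^ n) by ring. exact H4. }
    nra.
  - apply pow_incr. pose proof (exp_ineq1_le (- s)). lra.
Qed.

Lemma quartic_beta_squeeze (n : nat) :
  (0 < n)%nat ->
  quartic_exp_integral (root4 (INR n)) - root4 (INR n) / INR n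
  <= root4 (INR n) * quartic_beta n <= quartic_exp_integral (root4 (INR n)).
Proof.
  intros Hn. assert (Hn0 : 0 < INR n) by (apply lt_0_INR; lia).
  pose proof (root4_pow _ Hn0) as HT. pose proof (root4_pos (INR n)) as HT0.
  set (T := root4 (INR n)) in *.
  assert (HE : is_RInt (fun v => T * exp (- (INR n * v ^ 4))) 0 1 (quartic_exp_integral T)).
  { apply is_RInt_ext with (f := fun v => scal T (exp (- (T * v + 0) ^ 4))).
    - intros v _. rewrite Rplus_0_r, Rpow_mult_distr, HT. reflexivity.
    - apply (is_RInt_comp_lin (V := R_NormedModule) (fun u => exp (- u ^ 4)) T 0 0 1).
      replace (T * 0 + 0) with 0 by ring. replace (T * 1 + 0) with T by ring.
      apply (RInt_correct (V := R_CompleteNormedModule)), ex_RInt_quartic_exp. }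
  assert (HI : is_RInt (fun v => T * (1 - v ^ 4) ^ n) 0 1 (T * quartic_beta n)).
  { apply (is_RInt_scal (V := R_NormedModule)).
    apply (RInt_correct (V := R_CompleteNormedModule)), ex_RInt_quartic_beta. }
  assert (HC : is_RInt (fun _ => T / INR n) 0 1 (T / INR n)).
  { pose proof (is_RInt_const (V := R_NormedModule) 0 1 (T / INR n)) as H.
    change (is_RInt (fun _ => T / INR n) 0 1 ((1 - 0) * (T / INR n))) in H.
    now rewrite Rminus_0_r, Rmult_1_l in H. }
  assert (Hs : forall v, 0 < v < 1 -> 0 <= v ^ 4 <= 1).
  { intros v Hv. split; [ apply pow_le; lra | ].
    rewrite <- (pow1 4). apply pow_incr. lra. }
  split.
  - apply (is_RInt_le (fun v => T * exp (- (INR n * v ^ 4)) - T / INR n)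
      (fun v => T * (1 - v ^ 4) ^ n) 0 1); [ lra | | exact HI | ].
    + apply (is_RInt_minus (V := R_NormedModule)); assumption.
    + intros v Hv. pose proof (pow_one_sub_bounds n (v ^ 4) Hn (Hs v Hv)).
      unfold Rdiv. nra.
  - apply (is_RInt_le (fun v => T * (1 - v ^ 4) ^ n)
      (fun v => T * exp (- (INR n * v ^ 4))) 0 1); [ lra | exact HI | exact HE | ].
    intros v Hv. pose proof (pow_one_sub_bounds n (v ^ 4) Hn (Hs v Hv)). nra.
Qed.

(** In [quartic_beta_squeeze] the two bounds differ by n^(1/4) / n, which tends
    to 0. *)
Theorem Gauss_product_quarter :
  is_lim_seq (fun n => root4 (INR n) * prod_from_1 (fun k => 4 * INR k / (4 * INR k + 1)) n)
    (Gamma (1 / 4) / 4).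
Proof.
  apply is_lim_seq_ext with (fun n => root4 (INR n) * quartic_beta n).
  { intro n. now rewrite quartic_beta_prod. }
  assert (Hroot : is_lim_seq (fun n => root4 (INR n)) p_infty).
  { apply is_lim_seq_spec. intro M.
    pose proof is_lim_seq_INR as HI. apply is_lim_seq_spec in HI.
    destruct (HI (Rmax M 0 ^ 4)) as [N HN]. exists N. intros n Hn. specialize (HN n Hn).
    pose proof (Rmax_l M 0). pose proof (Rmax_r M 0).
    pose proof (pow_le (Rmax M 0) 4 ltac:(assumption)).
    apply Rle_lt_trans with (Rmax M 0); [ assumption | ].
    apply lt_root4; [ lra | assumption | assumption ]. }
  assert (HE : is_lim_seq (fun n => quartic_exp_integral (root4 (INR n))) (Gamma (1 / 4) / 4)).
  { apply is_lim_comp_seq with p_infty; [ apply Gamma_quarter | | exact Hroot ].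
    exists O. discriminate. }
  assert (HD : is_lim_seq (fun n => root4 (INR n) / INR n) 0).
  { apply is_lim_seq_ext_loc with (fun n => / root4 (INR n) ^ 3).
    - exists 1%nat. intros n Hn. assert (Hn0 : 0 < INR n) by (apply lt_0_INR; lia).
      rewrite <- (root4_pow _ Hn0) at 3. pose proof (root4_pos (INR n)). field. lra.
    - change (Finite 0) with (Rbar_inv p_infty).
      apply is_lim_seq_inv; [ | discriminate ].
      apply is_lim_seq_le_p_loc with (2 := Hroot).
      apply is_lim_seq_spec in Hroot. destruct (Hroot 1) as [N HN].
      exists N. intros n Hn. specialize (HN n Hn). simpl. nra. }
  apply is_lim_seq_le_le_loc with
    (fun n => quartic_exp_integral (root4 (INR n)) - root4 (INR n) / INR n)
    (fun n => quartic_exp_integral (root4 (INR n))).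
  - exists 1%nat. intros n Hn. apply quartic_beta_squeeze. lia.
  - replace (Gamma (1 / 4) / 4) with (Gamma (1 / 4) / 4 - 0) by ring.
    now apply is_lim_seq_minus'.
  - exact HE.
Qed.

(** * The sum over the base *)

Lemma is_lim_seq_ln (u : nat -> R) (l : R) :
  0 < l -> is_lim_seq u l -> is_lim_seq (fun n => ln (u n)) (ln l).
Proof.
  intros Hl Hu. apply is_lim_seq_continuous; [ | exact Hu ].
  apply derivable_continuous_pt. exists (/ l). now apply derivable_pt_lim_ln.
Qed.

(** The logarithms telescope to - ln (2m + 1) / 4.  This is balanced by half of
    harmonic (2m) - harmonic m / 2, which grows like ln m / 4; the difference of
    the two logarithms is - ln (2 + 1/m) / 4. *)
Theorem floor_gf_series_half :
  is_series (fun n => floor_gf (1 / 2 / INR (S n))) ((ln 2 + euler_gamma) / 4).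
Proof.
  apply is_series_telescope with
    (G := fun m => (harmonic (2 * m) - harmonic m / 2) / 2 - ln (2 * INR m + 1) / 4).
  - simpl (2 * 0)%nat. rewrite harmonic_0. simpl INR.
    replace (2 * 0 + 1) with 1 by ring. rewrite ln_1. field.
  - intro n. pose proof (pos_INR n).
    replace (2 * S n)%nat with (S (S (2 * n))) by lia.
    rewrite !harmonic_S, !S_INR, mult_INR. change (INR 2) with 2.
    rewrite floor_gf_div by lra.
    replace (INR n + 1 - 1 / 2) with ((2 * INR n + 1) / 2) by field.
    replace (INR n + 1 + 1 / 2) with ((2 * (INR n + 1) + 1) / 2) by field.
    rewrite !ln_div by lra. field. lra.
  - pose proof is_lim_harmonic_half as H1.
    assert (H2 : is_lim_seq (fun n => ln (2 + / INR n)) (ln (2 + 0))).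
    { apply is_lim_seq_ln; [ lra | ].
      apply is_lim_seq_plus'; [ apply is_lim_seq_const | ].
      change (Finite 0) with (Rbar_inv p_infty).
      apply is_lim_seq_inv; [ apply is_lim_seq_INR | discriminate ]. }
    rewrite Rplus_0_r in H2.
    pose proof (is_lim_seq_minus' _ _ _ _
      (is_lim_seq_scal_l _ (/ 2) _ H1) (is_lim_seq_scal_l _ (/ 4) _ H2)) as H.
    replace ((ln 2 + euler_gamma) / 4)
      with (/ 2 * (ln 2 + euler_gamma / 2) - / 4 * ln 2) by field.
    apply is_lim_seq_ext_loc with (2 := H).
    exists 1%nat. intros n Hn. assert (0 < INR n) by (apply lt_0_INR; lia).
    replace (2 + / INR n) with ((2 * INR n + 1) / INR n) by (field; lra).
    rewrite ln_div by lra. field.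
Qed.

Lemma prod_from_1_quarter_split (n : nat) :
  prod_from_1 (fun k => (4 * INR k - 1) / (4 * INR k + 1)) n =
  prod_from_1 (fun k => 1 - (1 / 2 / (2 * INR k)) ^ 2) n *
  prod_from_1 (fun k => 4 * INR k / (4 * INR k + 1)) n ^ 2.
Proof.
  induction n as [|n IH]; [ simpl; ring | ].
  rewrite !prod_from_1_S, IH, S_INR. pose proof (pos_INR n). field. lra.
Qed.

(** The factor m^(1/2) that makes the product converge is the square of the
    m^(1/4) of Gauss's product. *)
Lemma is_lim_prod_quarter :
  is_lim_seq
    (fun n => ln (prod_from_1 (fun k => (4 * INR k - 1) / (4 * INR k + 1)) n) + ln (INR n) / 2)
    (2 * ln (Gamma (1 / 4)) - ln PI - 5 / 2 * ln 2).
Proof.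
  destruct Gamma_quarter as [HG _]. pose proof PI_RGT_0 as Hpi.
  assert (Hs : 0 < sqrt 2) by (apply sqrt_lt_R0; lra).
  assert (Hlnsqrt : ln (sqrt 2) = / 2 * ln 2)
    by (rewrite <- Rpower_sqrt by lra; apply ln_Rpower).
  pose proof (sine_product (1 / 2) ltac:(lra)) as H1.
  replace (1 / 2 * (PI / 2)) with (PI / 4) in H1 by field. rewrite sin_PI4 in H1.
  pose proof Gauss_product_quarter as H2.
  pose proof (is_lim_seq_mult' _ _ _ _ H1 (is_lim_seq_mult' _ _ _ _ H2 H2)) as H.
  apply is_lim_seq_ln in H.
  2:{ repeat first [ lra | apply Rdiv_lt_0_compat | apply Rmult_lt_0_compat ]. }
  replace (2 * ln (Gamma (1 / 4)) - ln PI - 5 / 2 * ln 2)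
    with (ln (1 / sqrt 2 / (PI / 4) * (Gamma (1 / 4) / 4 * (Gamma (1 / 4) / 4)))).
  2:{ assert (H4 : ln 4 = 2 * ln 2)
        by (replace 4 with (2 * 2) by ring; rewrite ln_mult by lra; ring).
      assert (0 < 1 / sqrt 2) by (apply Rdiv_lt_0_compat; lra).
      assert (0 < Gamma (1 / 4) / 4) by lra.
      rewrite !ln_mult, !ln_div, ln_1, Hlnsqrt, H4;
        try lra; try field;
        repeat first [ lra | apply Rdiv_lt_0_compat | apply Rmult_lt_0_compat ]. }
  apply is_lim_seq_ext_loc with (2 := H).
  exists 1%nat. intros n Hn. assert (Hn0 : 0 < INR n) by (apply lt_0_INR; lia).
  rewrite prod_from_1_quarter_split.
  assert (HP : 0 < prod_from_1 (fun k => 1 - (1 / 2 / (2 * INR k)) ^ 2) n).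
  { apply prod_from_1_pos. intro k. rewrite S_INR. pose proof (pos_INR k).
    replace (1 - (1 / 2 / (2 * (INR k + 1))) ^ 2)
      with ((16 * (INR k + 1) ^ 2 - 1) / (16 * (INR k + 1) ^ 2)) by (field; lra).
    apply Rdiv_lt_0_compat; nra. }
  assert (HQ : 0 < prod_from_1 (fun k => 4 * INR k / (4 * INR k + 1)) n).
  { apply prod_from_1_pos. intro k. rewrite S_INR. pose proof (pos_INR k).
    apply Rdiv_lt_0_compat; lra. }
  revert HP HQ. generalize (prod_from_1 (fun k => 1 - (1 / 2 / (2 * INR k)) ^ 2) n) as P.
  generalize (prod_from_1 (fun k => 4 * INR k / (4 * INR k + 1)) n) as Q. intros Q P HP HQ.
  pose proof (root4_pos (INR n)) as Hr.
  assert (Hlr : ln (root4 (INR n)) = 1 / 4 * ln (INR n)) by apply ln_Rpower.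
  assert (0 < root4 (INR n) * Q) by now apply Rmult_lt_0_compat.
  simpl pow. rewrite Rmult_1_r, !ln_mult, Hlr; try lra;
    now apply Rmult_lt_0_compat.
Qed.

(** The sum of the 1 / (4n - 1) is half the difference between the sum of the
    reciprocals of all odd numbers below 4m and the Leibniz partial sum. *)
Theorem floor_gf_series_quarter :
  is_series (fun n => floor_gf (1 / 4 / INR (S n)))
    (1 / 4 * (2 * ln (Gamma (1 / 4)) + euler_gamma / 2 - PI / 4 - ln (2 * PI))).
Proof.
  set (P := prod_from_1 (fun k => (4 * INR k - 1) / (4 * INR k + 1))).
  assert (HP : forall n, 0 < P n).
  { intro n. apply prod_from_1_pos. intro k. rewrite S_INR. pose proof (pos_INR k).
    apply Rdiv_lt_0_compat; lra. }
  apply is_series_telescope with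
    (G := fun m => (harmonic (2 * (2 * m)) - harmonic (2 * m) / 2) / 4
                   - leibniz_sum m / 4 + ln (P m) / 4).
  - simpl (2 * (2 * 0))%nat. simpl (2 * 0)%nat. rewrite harmonic_0.
    unfold P, prod_from_1, leibniz_sum. rewrite ln_1. field.
  - intro n. pose proof (pos_INR n).
    replace (2 * (2 * S n))%nat with (S (S (S (S (2 * (2 * n)))))) by lia.
    replace (2 * S n)%nat with (S (S (2 * n))) by lia.
    rewrite !harmonic_S, leibniz_sum_S. unfold P at 1. rewrite prod_from_1_S. fold P.
    rewrite !S_INR, !mult_INR. change (INR 2) with 2.
    rewrite floor_gf_div by lra.
    replace (INR n + 1 - 1 / 4) with ((4 * (INR n + 1) - 1) / 4) by field.
    replace (INR n + 1 + 1 / 4) with ((4 * (INR n + 1) + 1) / 4) by field.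
    rewrite ln_mult, !ln_div; try lra; [ | apply HP | apply Rdiv_lt_0_compat; lra ].
    field. lra.
  - pose proof (is_lim_seq_mul_index _ _ 2 ltac:(lia) is_lim_harmonic_half) as H1.
    cbv beta in H1.
    pose proof (is_lim_seq_plus' _ _ _ _
      (is_lim_seq_minus' _ _ _ _ H1 is_lim_leibniz)
      (is_lim_seq_plus' _ _ _ _ is_lim_prod_quarter (is_lim_seq_const (ln 2 / 2)))) as H.
    apply (is_lim_seq_scal_l _ (1 / 4)) in H.
    rewrite ln_mult by (try apply PI_RGT_0; lra).
    replace (1 / 4 * (2 * ln (Gamma (1 / 4)) + euler_gamma / 2 - PI / 4 - (ln 2 + ln PI)))
      with (1 / 4 * (ln 2 + euler_gamma / 2 - PI / 4 +
         (2 * ln (Gamma (1 / 4)) - ln PI - 5 / 2 * ln 2 + ln 2 / 2))) by field.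
    apply is_lim_seq_ext_loc with (2 := H).
    exists 1%nat. intros n Hn. fold P.
    rewrite mult_INR, ln_mult; [ | simpl; lra | apply lt_0_INR; lia ].
    change (INR 2) with 2. field.
Qed.

Theorem proposition14 :
  series_from 2
    (fun k : nat => Rfloor (INR k / 2) * (zeta (INR k) / (INR k * 2 ^ k)))
    ((ln 2 + euler_gamma) / 4)
  /\
  series_from 2
    (fun k : nat => Rfloor (INR k / 2) * (zeta (INR k) / (INR k * 2 ^ (2 * k))))
    (1 / 4 * (2 * ln (Gamma (1 / 4)) + euler_gamma / 2 - PI / 4 - ln (2 * PI))).
Proof.
  assert (Hk : forall n, INR (2 + n) <> 0) by (intro n; apply not_0_INR; lia).
  split.
  - apply is_series_ext
      with (2 := floor_zeta_series (1 / 2) _ ltac:(lra) floor_gf_series_half).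
    intro n. apply (f_equal (Rmult (Rfloor (INR (2 + n) / 2)))).
    replace ((1 / 2) ^ (2 + n)) with (/ 2 ^ (2 + n))
      by (rewrite <- pow_inv; f_equal; field).
    field. split; [ apply pow_nonzero; lra | apply Hk ].
  - apply is_series_ext
      with (2 := floor_zeta_series (1 / 4) _ ltac:(lra) floor_gf_series_quarter).
    intro n. apply (f_equal (Rmult (Rfloor (INR (2 + n) / 2)))).
    rewrite pow_mult. replace (2 ^ 2) with 4 by ring.
    replace ((1 / 4) ^ (2 + n)) with (/ 4 ^ (2 + n))
      by (rewrite <- pow_inv; f_equal; field).
    field. split; [ apply pow_nonzero; lra | apply Hk ].
Qed.
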